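(* Suppose $n$ sensor nodes are deployed independently and uniformly at random in a cube of volume $V$ in $\mathbb{R}^3$, with common transmission range $$r_{\mathrm{Trans}}=\sqrt[3]{\frac{3(1+\ell)\ln n\, V}{4\pi n}},\qquad \ell>11/5,$$ and two nodes adjacent iff their distance is at most $r_{\mathrm{Trans}}$. Let $D$ be the hop-diameter of the resulting network. Then $$\lim_{n\to\infty}\Pr\left[D\le 12\sqrt[3]{\frac{\pi n}{6(1+\ell)\ln n}}\right]=1.$$
   Context: The hop distance between two nodes is the number of edges in a shortest path between them; the hop-diameter is the maximum hop distance over all pairs of nodes. Asymptotics are as $n\to\infty$ with $V=V(n)$ growing so that $n/V\to\rho$ for a constant $\rho$. *)

(* Defs.v *)
From HB Require Import structures.
From mathcomp Require Import all_boot all_order all_algebra.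
From mathcomp Require Import all_classical all_reals all_analysis.
Set Implicit Arguments. Unset Strict Implicit. Unset Printing Implicit Defensive.
Import Order.TTheory GRing.Theory Num.Theory.
Import numFieldNormedType.Exports.
Local Open Scope classical_set_scope.
Local Open Scope ring_scope.

Section RGG.
Variable R : realType.

Definition dist3 (p q : 'I_3 -> R) : R :=
  Num.sqrt (\sum_(c < 3) (p c - q c) ^+ 2).

Definition rgg_adj n (p : 'I_n -> 'I_3 -> R) (r : R) : rel 'I_n :=
  fun i j => (i != j) && (dist3 (p i) (p j) <= r).

Definition walk n (e : rel 'I_n) (x y : 'I_n) (k : nat) : Prop :=
  exists s : seq 'I_n, [/\ path e x s, last x s = y & size s = k].

(* hop distance: number of edges of a shortest path (+oo if none) *)
Definition hop_dist n (e : rel 'I_n) (x y : 'I_n) : \bar R :=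
  ereal_inf [set (k%:R)%:E | k in [set k | walk e x y k]].

Definition hop_diameter n (e : rel 'I_n) : \bar R :=
  \big[Order.max/0%E]_(x < n) \big[Order.max/0%E]_(y < n) hop_dist e x y.

(* The n nodes X i (with coordinates X i c) are independent and uniformly
   distributed in the cube [0,s]^3: measurable, and their joint law on every
   closed box prod_{i,c} [a i c, b i c] is the product of the normalized
   Lebesgue lengths (closed boxes determine the joint law on R^(3n)). *)
Definition iid_uniform_cube d (Omega : measurableType d)
  (P : probability Omega R) n (s : R) (X : 'I_n -> 'I_3 -> Omega -> R) : Prop :=
  (forall i c, measurable_fun setT (X i c)) /\
  forall a b : 'I_n -> 'I_3 -> R,
    P [set w | forall i c, a i c <= X i c w <= b i c] =
    (\prod_(i < n) \prod_(c < 3)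
       (fine (lebesgue_measure (`[a i c, b i c] `&` `[0, s])) / s))%:E.

End RGG.

(* Main.v *)
Require Import Defs.
From HB Require Import structures.
From Stdlib Require Import NArith.
From mathcomp Require Import all_boot all_order all_algebra.
From mathcomp Require Import all_classical all_reals all_analysis.
From mathcomp Require Import measurable_realfun.
From mathcomp Require Import zify ring lra.
Set Implicit Arguments. Unset Strict Implicit. Unset Printing Implicit Defensive.

(** Write [s] for the side of the cube and [q = s / r]: the claimed bound is [6 q]. Cut the
    cube into [m^3] closed cells of side [s / m], just below [r / 50]. Counting the ways of
    placing the nodes in the remaining cells, a fixed set of [k] cells contains no node with
    probability at most [exp (- k n / m^3)], so a union bound shows that with high probability

    - no bounded block of cells contains more than [k0] empty ones, for a constant [k0] that
      does not depend on the size of the block;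
    - from every cell there is a nonempty cell strictly further in the direction of the first
      axis, all of whose points are within [r] of the cell.

    The second event concerns half balls, halved once more for each of the two other axes
    along which the cell is close to the boundary. There are about [n^((3 - j) / 3)] cells with
    [j] such axes, so what is needed is that an octant of the ball of radius [r] carries mass
    more than [ln n / 3], which it does for [l > 11/5].

    The rest is deterministic. Two nodes at bounded distance both walk forward, by the second
    event, until they enter one of [k0 + 1] slabs that has no empty cell at all, and meet
    there; this costs boundedly many hops. Two arbitrary nodes are joined along three
    axis-parallel lines by hops of 40 cells, the empty cells met on the way, a small
    proportion by the first event, being bypassed locally. As 3 * 50 / 40 < 6, this takes fewer
    than [6 q] hops. *)

(** * Routing through nonempty cells *)

Section Reach.
Variables (n : nat) (e : rel 'I_n).

Definition reach (k : nat) (x y : 'I_n) : Prop :=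
  exists s : seq 'I_n, [/\ path e x s, last x s = y & size s <= k].

Lemma reach_refl k x : reach k x x.
Proof. by exists [::]. Qed.

Lemma reach_edge x y : x = y \/ e x y -> reach 1 x y.
Proof.
case=> [->|exy]; first exact: reach_refl.
by exists [:: y]; rewrite /= exy.
Qed.

Lemma reach_leq j k x y : j <= k -> reach j x y -> reach k x y.
Proof. by move=> jk [s [ps ls zs]]; exists s; split=> //; apply: leq_trans jk. Qed.

Lemma reach_trans j k x y z : reach j x y -> reach k y z -> reach (j + k) x z.
Proof.
move=> [s [ps ls zs]] [t [pt lt zt]]; exists (s ++ t).
by rewrite cat_path ps ls pt last_cat ls lt size_cat leq_add.
Qed.

Lemma reach_sym k x y : symmetric e -> reach k x y -> reach k y x.
Proof.
move=> esym [s [ps <- zs]]; exists (rev (belast x s)); split.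
- by rewrite rev_path (eq_path (e' := e)) // => u v; rewrite /= esym.
- by case: s {ps zs} => [|a s] //=; rewrite rev_cons last_rcons.
- by rewrite size_rev size_belast.
Qed.

End Reach.

Definition cell := (nat * nat * nat)%type.

Definition absd (a b : nat) : nat := (a - b) + (b - a).

(* Points of two such cells are at distance at most 50 cell sides. *)
Definition nearby (c c' : cell) : bool :=
  (absd c.1.1 c'.1.1).+1 ^ 2 + (absd c.1.2 c'.1.2).+1 ^ 2
    + (absd c.2 c'.2).+1 ^ 2 <= 50 ^ 2.

Definition in_grid (m : nat) (c : cell) : bool :=
  [&& c.1.1 < m, c.1.2 < m & c.2 < m].

Definition in_block (b : cell) (L : nat) (c : cell) : bool :=
  [&& b.1.1 <= c.1.1 < b.1.1 + L, b.1.2 <= c.1.2 < b.1.2 + L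
    & b.2 <= c.2 < b.2 + L].

Definition close (D : nat) (c c' : cell) : bool :=
  [&& absd c.1.1 c'.1.1 <= D, absd c.1.2 c'.1.2 <= D & absd c.2 c'.2 <= D].

Lemma near_absd c c' : nearby c c' ->
  [/\ absd c.1.1 c'.1.1 < 50, absd c.1.2 c'.1.2 < 50 & absd c.2 c'.2 < 50].
Proof.
rewrite /nearby => h; split; rewrite -(leq_exp2r _ _ (e := 2)) //;
  apply: leq_trans h.
- by rewrite -addnA leq_addr.
- by rewrite addnAC leq_addl.
- by rewrite leq_addl.
Qed.

Lemma near_le p q r c c' :
  absd c.1.1 c'.1.1 <= p -> absd c.1.2 c'.1.2 <= q -> absd c.2 c'.2 <= r ->
  p.+1 ^ 2 + q.+1 ^ 2 + r.+1 ^ 2 <= 50 ^ 2 -> nearby c c'.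
Proof.
move=> hp hq hr; apply: leq_trans.
by rewrite !leq_add // leq_exp2r.
Qed.

Lemma near_close1 c c' : close 1 c c' -> nearby c c'.
Proof. by case/and3P=> h1 h2 h3; apply: (near_le h1 h2 h3). Qed.

(** * Meeting in a slab without empty cells *)

Section Occupancy.
Variables (n : nat) (e : rel 'I_n) (inc : 'I_n -> cell -> Prop).

Definition occ (c : cell) : Prop := exists i, inc i c.

Definition near_adjacent : Prop :=
  forall i j c c', nearby c c' -> inc i c -> inc j c' -> i = j \/ e i j.

Definition few_empty (m L k0 : nat) : Prop :=
  forall (b : cell) (S : seq cell), uniq S -> size S = k0.+1 ->
    all (fun c => in_grid m c && in_block b L c) S -> exists2 c, c \in S & occ c.

(** The cell [c] may be empty, so the property can be checked by a union bound over all cells. The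
    bound on [c.1.1] keeps every candidate, at most 49 layers ahead, inside the grid. *)
Definition forward_step (m : nat) : Prop :=
  forall c, in_grid m c -> c.1.1 + 50 <= m ->
    exists c', [/\ in_grid m c', c.1.1 < c'.1.1, nearby c c' & occ c'].

Lemma near_reach i j c c' : near_adjacent -> nearby c c' -> inc i c -> inc j c' ->
  reach e 1 i j.
Proof. by move=> adj nr ic jc; apply/reach_edge/(adj _ _ _ _ nr). Qed.

(** A step gains at least one layer, so [d] steps suffice, and fewer than 50, so the walk cannot
    jump over the 50 layers from [X] on. The sideways drift per step is bounded likewise. *)
Lemma forward_walk m d i c X : near_adjacent -> forward_step m ->
  inc i c -> in_grid m c -> X <= c.1.1 + d -> X + 50 <= m -> c.1.1 < X + 50 ->
  exists j c', [/\ reach e d i j, inc j c', in_grid m c', X <= c'.1.1 < X + 50 &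
    absd c.1.2 c'.1.2 <= 50 * d /\ absd c.2 c'.2 <= 50 * d].
Proof.
move=> adj fwd; elim: d i c => [|d IH] i c ic gc hX hm hc;
  have [le|lt] := leqP X c.1.1.
- by exists i, c; split; rewrite ?le //; [exact: reach_refl | rewrite /absd; lia].
- by lia.
- by exists i, c; split; rewrite ?le //; [exact: reach_refl | rewrite /absd; lia].
have [|c1 [g1 lt1 nr [k kc1]]] := fwd _ gc; first by lia.
have [d1 d2 d3] := near_absd nr.
have [||j [c' [rj jc' g' X' [a1 a2]]]] := IH k c1 kc1 g1 _ hm.
- by lia.
- by move: d1; rewrite /absd; lia.
exists j, c'; split=> //.
- by rewrite -add1n; apply: reach_trans rj; apply: near_reach nr ic kc1.
- by move: d2 d3 a1 a2; rewrite /absd; lia.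
Qed.

Definition toward (a b : nat) : nat := if a < b then a.+1 else if b < a then a.-1 else a.

Lemma towardP lo hi a b D : lo <= a <= hi -> lo <= b <= hi -> absd a b <= D.+1 ->
  [/\ lo <= toward a b <= hi, absd a (toward a b) <= 1 & absd (toward a b) b <= D].
Proof. by rewrite /toward /absd; case: ltngtP => ? ? ? ?; split; lia. Qed.

(** Moving one cell towards the target in all three coordinates at once lowers the largest
    coordinate distance by one. The extra hop joins distinct nodes once that distance is 0. *)
Lemma full_reach (lo hi : cell) D i j c c' : near_adjacent ->
  (forall u, lo.1.1 <= u.1.1 <= hi.1.1 -> lo.1.2 <= u.1.2 <= hi.1.2 ->
     lo.2 <= u.2 <= hi.2 -> occ u) ->
  lo.1.1 <= c.1.1 <= hi.1.1 -> lo.1.2 <= c.1.2 <= hi.1.2 -> lo.2 <= c.2 <= hi.2 ->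
  lo.1.1 <= c'.1.1 <= hi.1.1 -> lo.1.2 <= c'.1.2 <= hi.1.2 -> lo.2 <= c'.2 <= hi.2 ->
  inc i c -> inc j c' -> close D c c' -> reach e D.+1 i j.
Proof.
move=> adj full; move=> + + + c'1 c'2 c'3 + jc'.
elim: D i c => [|D IH] i c c1 c2 c3 ic /and3P[d1 d2 d3].
  by apply: (near_reach adj _ ic jc'); apply: near_close1; apply/and3P; split; lia.
pose u : cell := (toward c.1.1 c'.1.1, toward c.1.2 c'.1.2, toward c.2 c'.2).
have [u1 n1 k1] := towardP c1 c'1 d1; have [u2 n2 k2] := towardP c2 c'2 d2.
have [u3 n3 k3] := towardP c3 c'3 d3.
have [k ku] := full u u1 u2 u3.
rewrite -add1n; apply: (@reach_trans _ _ _ _ _ k).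
  by apply: (near_reach adj _ ic ku); apply: near_close1; apply/and3P.
by apply: (IH k u) => //; apply/and3P.
Qed.

(** Pigeonhole: an empty cell in each of [k0.+1] disjoint slabs would give [k0.+1] distinct empty
    cells in one block. The thickness 50 is that of the target window in [forward_walk]. *)
Lemma full_window m L k0 (b : cell) W : few_empty m L k0 ->
  b.1.1 + 50 * k0.+1 <= m -> 50 * k0.+1 <= L -> W <= L ->
  exists2 t, t <= k0 & forall u : cell,
    b.1.1 + 50 * t <= u.1.1 < b.1.1 + 50 * t.+1 ->
    b.1.2 <= u.1.2 < b.1.2 + W -> b.2 <= u.2 < b.2 + W ->
    u.1.2 < m -> u.2 < m -> occ u.
Proof.
move=> few bm kL WL; apply: contrapT => none.
(* The condition [t <= k0] stands under the quantifier so that [choice] yields a total function;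
   beyond [k0] the cell [b] is a dummy value. *)
have bad t : exists u : cell, t <= k0 ->
    [/\ b.1.1 + 50 * t <= u.1.1 < b.1.1 + 50 * t.+1,
    b.1.2 <= u.1.2 < b.1.2 + W, b.2 <= u.2 < b.2 + W, u.1.2 < m /\ u.2 < m & ~ occ u].
  apply: contrapT => nu; apply: none; exists t.
    by apply: contrapT => nt; apply: nu; exists b => ht; case: nt.
  move=> u u1 u2 u3 u4 u5; apply: contrapT => nocc; apply: nu.
  by exists u => _; split.
have [f fP] := choice bad.
have [||| c] := few b [seq f t | t <- iota 0 k0.+1].
- rewrite map_inj_in_uniq ?iota_uniq // => s t.
  rewrite !mem_iota /= => hs ht est.
  have [|s1 _ _ _ _] := fP s; first lia.
  have [|t1 _ _ _ _] := fP t; first lia.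
  by move: s1 t1; rewrite est; lia.
- by rewrite size_map size_iota.
- apply/allP => u /mapP[t]; rewrite mem_iota => ht ->.
  have [|t1 t2 t3 [t4 t5] _] := fP t; first lia.
  by rewrite /in_grid /in_block; lia.
- move=> /mapP[t]; rewrite mem_iota => ht ->.
  by have [|_ _ _ _] := fP t; first lia.
Qed.

(** Two walks of at most [R0 + 50 * k0.+1] hops, started within [R0] of each other, drift by at most
    50 cells a hop; a window of this width centred at one start contains both ends. *)
Definition local_width (R0 k0 : nat) : nat := 2 * (50 * (R0 + 50 * k0.+1) + R0) + 1.
Definition local_hops (R0 k0 : nat) : nat :=
  2 * (R0 + 50 * k0.+1) + (local_width R0 k0).+1.

Lemma forward_local_reach m L k0 R0 i j c c' :
  symmetric e -> near_adjacent -> few_empty m L k0 -> forward_step m ->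
  50 * k0.+1 <= L -> local_width R0 k0 <= L ->
  inc i c -> inc j c' -> in_grid m c -> in_grid m c' -> close R0 c c' ->
  c.1.1 + R0 + 50 * k0.+2 <= m -> reach e (local_hops R0 k0) i j.
Proof.
move=> esym adj few fwd kL wL ic jc' gc gc' /and3P[d1 d2 d3] hm.
pose d := R0 + 50 * k0.+1.
(* The slabs begin at the larger first coordinate, so that both walks only go forward. Truncated
   subtraction cuts the window at the faces of the grid. *)
pose b : cell := (maxn c.1.1 c'.1.1, c.1.2 - (50 * d + R0), c.2 - (50 * d + R0)).
have bx : b.1.1 <= c.1.1 + R0 by move: d1; rewrite /b /= /absd; lia.
have bx0 : c.1.1 <= b.1.1 /\ c'.1.1 <= b.1.1 by rewrite /b /=; lia.
have bx1 : b.1.1 <= c'.1.1 + R0 by move: d1; rewrite /b /= /absd; lia.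
have by_ : b.1.2 = c.1.2 - (50 * d + R0) by [].
have bz_ : b.2 = c.2 - (50 * d + R0) by [].
have dE : d = R0 + 50 * k0.+1 by [].
have wE : local_width R0 k0 = 2 * (50 * d + R0) + 1 by [].
have hE : local_hops R0 k0 = 2 * d + (local_width R0 k0).+1 by [].
clearbody b d.
have [| t tk full] := full_window (b := b) few _ kL wL; first lia.
have [||| i1 [c1 [r1 ic1 g1 X1 [y1 z1]]]] :=
  @forward_walk m d i c (b.1.1 + 50 * t) adj fwd ic gc; try lia.
have [||| j1 [c2 [r2 jc2 g2 X2 [y2 z2]]]] :=
  @forward_walk m d j c' (b.1.1 + 50 * t) adj fwd jc' gc'; try lia.
have /and3P[g11 g12 g13] := g1; have /and3P[g21 g22 g23] := g2.
have r3 : reach e (local_width R0 k0).+1 i1 j1.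
  (* [full] covers only cells of the grid, hence the clipping at [m.-1]. *)
  apply: (@full_reach (b.1.1 + 50 * t, b.1.2, b.2)
     (b.1.1 + 50 * t + 49, minn (b.1.2 + 2 * (50 * d + R0)) m.-1,
        minn (b.2 + 2 * (50 * d + R0)) m.-1) _ _ _ c1 c2) => //=.
  - by move=> u /= h1 h2 h3; apply: full; lia.
  - by lia.
  - by move: y1; rewrite /absd; lia.
  - by move: z1; rewrite /absd; lia.
  - by lia.
  - by move: y2 d2; rewrite /absd; lia.
  - by move: z2 d3; rewrite /absd; lia.
  - apply/and3P; move: y1 z1 y2 z2 d1 d2 d3; rewrite wE /absd.
    by clear -X1 X2 dE; split; lia.
have := reach_trans r1 (reach_trans r3 (reach_sym esym r2)).
by apply: reach_leq; rewrite hE; lia.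
Qed.

End Occupancy.

(** * Reflection of the first axis *)

Definition mirror (m : nat) (c : cell) : cell := (m.-1 - c.1.1, c.1.2, c.2).

(** The bound is there because truncated subtraction would send every layer beyond the grid to layer
    0. *)
Definition mirror_inc n m (inc : 'I_n -> cell -> Prop) (i : 'I_n) (c : cell) : Prop :=
  c.1.1 < m /\ inc i (mirror m c).

Section LocalReach.
Variables (n : nat) (e : rel 'I_n) (inc : 'I_n -> cell -> Prop).
Hypotheses (esym : symmetric e) (adj : near_adjacent e inc).

Lemma mirror_near m c c' : c.1.1 < m -> c'.1.1 < m ->
  nearby (mirror m c) (mirror m c') = nearby c c'.
Proof.
move=> h h'; rewrite /nearby /=.
by have -> : absd (m.-1 - c.1.1) (m.-1 - c'.1.1) = absd c.1.1 c'.1.1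
  by rewrite /absd; lia.
Qed.

Lemma mirror_few_empty m L k0 : few_empty inc m L k0 ->
  few_empty (mirror_inc m inc) m L k0.
Proof.
move=> few b S uS sS /allP aS.
(* For a block that sticks out of the grid this truncates to 0, and the mirrored cells still fit. *)
pose b' : cell := (m - (b.1.1 + L), b.1.2, b.2).
have inj : {in S &, injective (mirror m)}.
  move=> u v /aS /andP[/and3P[u1 _ _] _] /aS /andP[/and3P[v1 _ _] _].
  case: u u1 => [[x y] z] /= u1; case: v v1 => [[x' y'] z'] /= v1.
  by rewrite /mirror /= => -[] *; congr (_, _, _); lia.
have [|||c] := few b' (map (mirror m) S).
- by rewrite map_inj_in_uniq.
- by rewrite size_map.
- apply/allP => u /mapP[v /aS]; rewrite /in_grid /in_block => /andP[g1 b1 ->] /=.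
  by move: g1 b1; rewrite /b' /=; lia.
- move=> /mapP[v vS ->] [i iv]; exists v => //; exists i; split=> //.
  by have /andP[/and3P[]] := aS _ vS.
Qed.

(** As [m] is at least twice the room needed, there is room ahead of [c] or behind it; the second
    case is the first one in the mirrored grid. *)
Lemma local_reach m L k0 R0 i j c c' :
  few_empty inc m L k0 -> forward_step inc m -> forward_step (mirror_inc m inc) m ->
  50 * k0.+1 <= L -> local_width R0 k0 <= L ->
  2 * (R0 + 50 * k0.+2) <= m ->
  inc i c -> inc j c' -> in_grid m c -> in_grid m c' -> close R0 c c' ->
  reach e (local_hops R0 k0) i j.
Proof.
move=> few fwd bwd kL wL hm ic jc' gc gc' d.
have [le|lt] := leqP (c.1.1 + R0 + 50 * k0.+2) m.
  exact: (forward_local_reach esym adj few fwd kL wL ic jc').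
have adj' : near_adjacent e (mirror_inc m inc).
  move=> i1 j1 c1 c2 nr [h1 ic1] [h2 jc2].
  by apply: (adj _ ic1 jc2); rewrite mirror_near.
have /and3P[g1 g2 g3] := gc; have /and3P[g1' g2' g3'] := gc'.
have mK u : u.1.1 < m -> mirror m (mirror m u) = u.
  by case: u => [[x y] z] /= h; congr (_, _, _) => /=; lia.
apply: (forward_local_reach (c := mirror m c) (c' := mirror m c') esym adj'
  (mirror_few_empty few) bwd kL wL).
- by split; [rewrite /=; lia | rewrite mK].
- by split; [rewrite /=; lia | rewrite mK].
- by apply/and3P; split=> //=; lia.
- by apply/and3P; split=> //=; lia.
- by move: d; rewrite /close /= /absd => /and3P[? ? ?]; apply/and3P; split; lia.
- by rewrite /=; lia.
Qed.

End LocalReach.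

(** * Walking along a line of cells, with a station every 40 cells *)

Section Line.
Variables (n : nat) (e : rel 'I_n) (inc : 'I_n -> cell -> Prop).
Variables (line : nat -> cell) (T B k0 C : nat).
Hypothesis line_near : forall t t', t <= T -> t' <= T -> absd t t' <= 40 ->
  nearby (line t) (line t').
Hypothesis adj : near_adjacent e inc.
Hypothesis few : forall a S, uniq S -> size S = k0.+1 ->
  all (fun t => (a <= t < a + 40 * B) && (t <= T)) S -> exists2 t, t \in S & occ inc (line t).
Hypothesis loc : forall i j t t', t <= T -> t' <= T -> absd t t' <= 40 * k0.+1 ->
  inc i (line t) -> inc j (line t') -> reach e C i j.
Hypothesis kB : k0.+1 <= B.

Let N := T %/ 40.
Let empty (j : nat) : bool := ~~ `[< occ inc (line (40 * j)) >].

Lemma count_empty_block a K : K <= B -> a + K <= N.+1 ->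
  count empty (iota a K) <= k0.
Proof.
move=> KB aN; rewrite leqNgt; apply/negP => lt.
set F := [seq j <- iota a K | empty j].
have sF : k0.+1 <= size F by rewrite size_filter.
have subF : {subset take k0.+1 F <= F} by move=> x; apply: mem_take.
have [|||t] := few (a := 40 * a) (S := [seq 40 * j | j <- take k0.+1 F]).
- rewrite map_inj_uniq; last by move=> x y; lia.
  by rewrite take_uniq // filter_uniq // iota_uniq.
- by rewrite size_map size_takel.
- apply/allP => t /mapP[j /subF]; rewrite mem_filter mem_iota => /andP[_ jr] ->.
  by move: jr aN; rewrite /N; lia.
- move=> /mapP[j /subF]; rewrite mem_filter => /andP[ej _] ->.
  by move/asboolP; rewrite (negPf ej).
Qed.

Lemma count_empty q a K : K <= q * B -> a + K <= N.+1 ->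
  count empty (iota a K) <= q * k0.
Proof.
elim: q a K => [|q IH] a K; first by rewrite mul0n leqn0 => /eqP ->.
rewrite !mulSn => Kq aK; have [le|lt] := leqP K B.
  by apply: leq_trans (count_empty_block le aK) _; lia.
have -> : K = B + (K - B) by lia.
rewrite iotaD count_cat leq_add //.
  by apply: count_empty_block; lia.
by apply: IH; lia.
Qed.

(** Here [j'] is the last nonempty station up to [j]. Consecutive nonempty stations are one hop
    apart; a gap is bypassed in [C] hops, charged to its first empty station. A gap has at most [k0]
    stations because [k0.+1] consecutive ones fit into a block, so the bypass is local. *)
Lemma line_walk_prefix i : inc i (line 0) -> forall j, j <= N -> exists j' q,
  [/\ j' <= j, inc q (line (40 * j')),
      reach e (j' + C * count empty (iota 0 j'.+1)) i q,
      (forall u, j' < u <= j -> empty u) & j - j' <= k0].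
Proof.
move=> i0; elim=> [|j IH] jN.
  by exists 0, i; split=> //; [exact: reach_refl | lia].
have [j' [q [jj qj rq ej kj]]] := IH (ltnW jN).
have [em|] := boolP (empty j.+1).
  have ej' u : j' < u <= j.+1 -> empty u.
    have [->//|ne] := eqVneq u j.+1 => hu; apply: ej; lia.
  exists j', q; split=> //; first by lia.
  have : count empty (iota j'.+1 (j.+1 - j')) <= k0 by apply: count_empty_block; lia.
  have /eqP -> : count empty (iota j'.+1 (j.+1 - j')) == size (iota j'.+1 (j.+1 - j')).
    by rewrite -all_count; apply/allP => u; rewrite mem_iota => hu; apply: ej'; lia.
  by rewrite size_iota.
move=> nem; have /asboolP[p pj] : `[< occ inc (line (40 * j.+1)) >].
  by move: nem; rewrite /empty negbK.
exists j.+1, p.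
have jT : 40 * j.+1 <= T by move: jN; rewrite /N; lia.
have [eqj|ne] := eqVneq j' j.
  rewrite eqj in qj rq; split=> //; try lia.
  have nr : nearby (line (40 * j)) (line (40 * j.+1)).
    by apply: line_near; rewrite ?/absd; lia.
  apply: reach_leq (reach_trans rq (near_reach adj nr qj pj)).
  by rewrite -[in iota 0 j.+2]addn1 iotaD count_cat mulnDr; lia.
split=> //; try lia.
have rp : reach e C q p.
  by apply: (loc (t := 40 * j') (t' := 40 * j.+1)) => //; rewrite /absd; lia.
apply: reach_leq (reach_trans rq rp).
have e1 : empty j'.+1 by apply: ej; lia.
have -> : j.+2 = j'.+1 + (j - j').+1 by lia.
by rewrite iotaD count_cat add0n [iota j'.+1 _]/= [count _ (_ :: _)]/= e1; nia.
Qed.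

Lemma line_walk i : inc i (line 0) -> exists t q,
  [/\ t <= T, T <= t + 40 * k0.+1, inc q (line t) &
      reach e (N + C * ((N %/ B).+2 * k0)) i q].
Proof.
move=> i0; have [j' [q [jN qj rq _ kj]]] := line_walk_prefix i0 (leqnn N).
have TN : T = 40 * N + T %% 40 by rewrite mulnC -divn_eq.
have T40 : T %% 40 < 40 by rewrite ltn_mod.
exists (40 * j'), q; split=> //; try lia.
apply: reach_leq rq; apply: leq_add => //; rewrite leq_mul2l; apply/orP; right.
apply: count_empty; last lia.
have := divn_eq N B; have : N %% B < B by rewrite ltn_mod; lia.
rewrite !mulSn; lia.
Qed.

End Line.

(** * Crossing the grid along the three axes *)

Definition gap_radius (k0 : nat) : nat := 40 * k0.+1.
Definition gap_hops (k0 : nat) : nat := local_hops (gap_radius k0) k0.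
(** Counted in stations. The first term makes the bypasses of a block, at most [k0] of them, cost at
    most a tenth of a hop per station; the other terms meet the size conditions of [local_reach]. *)
Definition block_len (k0 : nat) : nat :=
  10 * gap_hops k0 * k0.+1 + local_width (gap_radius k0) k0 + 50 * k0.+1.
(** The first term is the room needed by [local_reach]; the second absorbs the hops in [grid_reach]
    whose number does not grow with [m]. *)
Definition grid_min (k0 : nat) : nat :=
  2 * (gap_radius k0 + 50 * k0.+2) + 30 * (6 * gap_hops k0 * k0 + gap_hops k0 + 1).

Section Diameter.
Variables (n : nat) (e : rel 'I_n) (inc : 'I_n -> cell -> Prop) (m k0 : nat).
Hypotheses (esym : symmetric e) (adj : near_adjacent e inc).
Hypothesis few : few_empty inc m (40 * block_len k0) k0.
Hypotheses (fwd : forward_step inc m) (bwd : forward_step (mirror_inc m inc) m).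
Hypothesis mM : grid_min k0 <= m.

Lemma grid_local_reach i j c c' : inc i c -> inc j c' -> in_grid m c -> in_grid m c' ->
  close (gap_radius k0) c c' -> reach e (gap_hops k0) i j.
Proof.
apply: (local_reach esym adj few fwd bwd).
- by rewrite /block_len; lia.
- by rewrite /block_len; lia.
- by apply: leq_trans mM; rewrite /grid_min leq_addr.
Qed.

(** Stations cost [m / 40] hops and bypasses in the [N %/ block_len k0] blocks a tenth of that,
    together [11 m / 400]; the constant pays for the two additional blocks. *)
Lemma line_hops_le N : N <= m %/ 40 ->
  400 * (N + gap_hops k0 * ((N %/ block_len k0).+2 * k0)) <=
  11 * m + 800 * (gap_hops k0 * k0).
Proof.
move=> Nm; have N40 : 40 * N <= m by lia.
set C := gap_hops k0; set B := block_len k0; set q := N %/ B.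
have qB : q * B <= N by exact: leq_trunc_div.
have : q * (10 * C * k0.+1) <= N.
  by apply: leq_trans qB; rewrite leq_mul2l /B /block_len -/C; lia.
have -> : C * (q.+2 * k0) = q * (C * k0) + 2 * (C * k0) by lia.
have -> : q * (10 * C * k0.+1) = 10 * (q * (C * k0)) + 10 * (q * C) by lia.
lia.
Qed.

(** What the walk needs of a coordinate line, so that the three axes share one proof. *)
Definition axis_map (f : nat -> cell) : Prop :=
  [/\ injective f, (forall u v, absd u v <= 40 -> nearby (f u) (f v)),
      (forall D u v, absd u v <= D -> close D (f u) (f v)),
      (forall a L u, a <= u < a + L -> in_block (f a) L (f u)) &
      (forall u, u < m -> in_grid m (f u))].

Lemma axis_map1 y z : y < m -> z < m -> axis_map (fun u => (u, y, z)).
Proof.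
move=> ym zm; split=> [u v []|u v d|D u v d|a L u|u um] //.
- by apply: (@near_le 40 0 0); move: d; rewrite /absd /=; lia.
- by apply/and3P; split; move: d; rewrite /absd /=; lia.
- by rewrite /in_block /=; lia.
- by rewrite /in_grid /=; lia.
Qed.

Lemma axis_map2 x z : x < m -> z < m -> axis_map (fun u => (x, u, z)).
Proof.
move=> xm zm; split=> [u v []|u v d|D u v d|a L u|u um] //.
- by apply: (@near_le 0 40 0); move: d; rewrite /absd /=; lia.
- by apply/and3P; split; move: d; rewrite /absd /=; lia.
- by rewrite /in_block /=; lia.
- by rewrite /in_grid /=; lia.
Qed.

Lemma axis_map3 x y : x < m -> y < m -> axis_map (fun u => (x, y, u)).
Proof.
move=> xm ym; split=> [u v []|u v d|D u v d|a L u|u um] //.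
- by apply: (@near_le 0 0 40); move: d; rewrite /absd /=; lia.
- by apply/and3P; split; move: d; rewrite /absd /=; lia.
- by rewrite /in_block /=; lia.
- by rewrite /in_grid /=; lia.
Qed.

Definition glide (a b t : nat) : nat := if a <= b then a + t else a - t.

Lemma axis_walk f a b i : axis_map f -> a < m -> b < m -> inc i (f a) ->
  exists u q k, [/\ u < m, absd u b <= gap_radius k0, inc q (f u), reach e k i q &
    400 * k <= 11 * m + 800 * (gap_hops k0 * k0)].
Proof.
move=> [finj fnear fclose fblock fgrid] am bm ia.
pose T := absd a b; pose line t := f (glide a b t).
have glide_absd t t' : t <= T -> t' <= T ->
    absd (glide a b t) (glide a b t') = absd t t'.
  by rewrite /T /glide /absd; case: (leqP a b); lia.
have glide_m t : t <= T -> glide a b t < m.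
  by rewrite /T /glide /absd; case: (leqP a b); lia.
have glideT t : t <= T -> absd (glide a b t) b = T - t.
  by rewrite /T /glide /absd; case: (leqP a b); lia.
have glide0 : glide a b 0 = a by rewrite /glide addn0 subn0 if_same.
have [|||||t [q [tT Tt qt rq]]] := @line_walk n e inc line T (block_len k0) k0
    (gap_hops k0) _ adj _ _ _ i.
- by move=> t t' tT t'T d; apply: fnear; rewrite glide_absd.
- move=> a0 S uS sS /allP aS.
  (* On a descending walk the positions [a - t] with [t >= a0] run down from [a - a0], so the corner
     of the block is its lowest cell. *)
  pose a1 := if a <= b then a + a0 else (a - a0).+1 - 40 * block_len k0.
  have injg : {in S &, injective (line)}.
    move=> t t' /aS /andP[_ tT] /aS /andP[_ t'T] /finj ett.
    by have := glide_absd _ _ tT t'T; rewrite ett /absd; lia.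
  have [|||c] := few (b := f a1) (S := map line S).
  - by rewrite map_inj_in_uniq.
  - by rewrite size_map.
  - apply/allP => c /mapP[t /aS /andP[ht tT] ->]; apply/andP; split.
      by apply: fgrid; apply: glide_m.
    apply: fblock; move: ht tT; rewrite /a1 /glide /T /absd; case: (leqP a b); lia.
  - by move=> /mapP[t tS ->] ot; exists t.
- move=> i1 j1 t t' tT t'T d h1 h2.
  apply: (grid_local_reach h1 h2); try by apply: fgrid; apply: glide_m.
  by apply: fclose; rewrite glide_absd.
- by rewrite /block_len; lia.
- by rewrite /line glide0.
exists (glide a b t), q, (T %/ 40 + gap_hops k0 * ((T %/ 40 %/ block_len k0).+2 * k0)).
split=> //.
- exact: glide_m.
- by rewrite glideT // /gap_radius; lia.
- by apply: line_hops_le; apply: leq_div2r; rewrite /T /absd; lia.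
Qed.

(** Each leg corrects one coordinate up to [gap_radius k0] and keeps the other two, so a single
    local route removes all three errors at the end. The legs cost about [33 m / 400], below
    [3 m / 25]; the summand 3 allows for the rounding in the choice of [m]. *)
Lemma grid_reach i j : (forall i, exists2 c, in_grid m c & inc i c) ->
  exists2 k, reach e k i j & 25 * k + 3 <= 3 * m.
Proof.
move=> cov.
have [[[x y] z] /and3P[/= xm ym zm] ic] := cov i.
have [[[x' y'] z'] /and3P[/= xm' ym' zm'] jc] := cov j.
have [x1 [q1 [k1 [x1m d1 i1 r1 h1]]]] := axis_walk (axis_map1 ym zm) xm xm' ic.
have [y1 [q2 [k2 [y1m d2 i2 r2 h2]]]] := axis_walk (axis_map2 x1m zm) ym ym' i1.
have [z1 [q3 [k3 [z1m d3 i3 r3 h3]]]] := axis_walk (axis_map3 x1m y1m) zm zm' i2.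
have r4 : reach e (gap_hops k0) q3 j.
  by apply: (grid_local_reach i3 jc); apply/and3P.
exists (k1 + (k2 + (k3 + gap_hops k0))).
  exact: reach_trans r1 (reach_trans r2 (reach_trans r3 r4)).
move: mM; rewrite /grid_min -mulnA; lia.
Qed.

End Diameter.

(** * Cells in an octant of a ball *)

(** Displacements between cells; the coordinates are nonzero so that reflected copies are
    disjoint. *)
Definition octant : {set 'I_50 * 'I_50 * 'I_50} :=
  [set v : 'I_50 * 'I_50 * 'I_50 | [&& 0 < v.1.1, 0 < v.1.2, 0 < v.2
    & v.1.1.+1 ^ 2 + v.1.2.+1 ^ 2 + v.2.+1 ^ 2 <= 50 ^ 2]].

(** Membership in [octant] in binary arithmetic, fit for evaluation. *)
Definition octant_N (i j k : nat) : bool :=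
  [&& i != 0, j != 0, k != 0 &
   let sq a := (N.of_nat a * N.of_nat a)%num in
   N.leb (sq i.+1 + sq j.+1 + sq k.+1)%num 2500%num].

Definition sumN (f : nat -> N) : N := foldr (fun i s => (f i + s)%num) 0%num (iota 0 50).

Lemma sumNE (f : nat -> N) (g : nat -> nat) : (forall i, N.to_nat (f i) = g i) ->
  N.to_nat (sumN f) = \sum_(i < 50) g i.
Proof.
move=> fg; rewrite -(big_mkord xpredT g) /sumN /index_iota subn0.
elim: (iota 0 50) => [|i s IH] /=; first by rewrite big_nil.
by rewrite big_cons N2Nat.inj_add IH fg.
Qed.

(** By evaluation there are 56934 displacements, against a volume of about 65450 for an octant of
    the ball of radius 50. The proportion 9/20 is what [xi_le] uses. *)
Lemma card_octant : 9 * 50 ^ 3 <= 20 * #|octant|.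
Proof.
have sqE a : N.to_nat (N.of_nat a * N.of_nat a)%num = a ^ 2 by lia.
have octE (i j k : 'I_50) : octant_N i j k = ((i, j, k) \in octant).
  by rewrite inE /octant_N /= -!lt0n; do 3!congr (_ && _); lia.
have -> : #|octant| =
    \sum_(i < 50) \sum_(j < 50) \sum_(k < 50) (if octant_N i j k then 1 else 0).
  rewrite !pair_bigA -sum1_card big_mkcond.
  by apply: eq_bigr => -[[i j] k] _; rewrite octE.
set S := \sum_(i < 50) _.
have -> : S = N.to_nat (sumN (fun i => sumN (fun j => sumN (fun k =>
    if octant_N i j k then 1 else 0)%num))).
  pose F i j k := if octant_N i j k then 1 else 0.
  apply: esym; apply: (@sumNE _ (fun i => \sum_(j < 50) \sum_(k < 50) F i j k)) => i.
  apply: (@sumNE _ (fun j => \sum_(k < 50) F i j k)) => j.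
  by apply: (@sumNE _ (F i j)) => k; rewrite /F; case: ifP.
have -> : sumN (fun i => sumN (fun j => sumN (fun k =>
    if octant_N i j k then 1 else 0)%num)) = 56934%num by vm_compute.
lia.
Qed.

Import Order.TTheory GRing.Theory Num.Theory.
Import numFieldNormedType.Exports.
Local Open Scope classical_set_scope.
Local Open Scope ring_scope.

(** * Probability of empty cells *)

Section UnionBound.
Variables (R : realType) (d : measure_display) (Omega : measurableType d).
Variable P : probability Omega R.

Lemma measurable_finite_exists (I : finType) (Q : pred I) (A : I -> set Omega) :
  (forall i, Q i -> measurable (A i)) -> measurable [set w | exists2 i, Q i & A i w].
Proof.
move=> mA; have -> : [set w | exists2 i, Q i & A i w] = \bigcup_(i in [set i | Q i]) A i by [].
by apply: fin_bigcup_measurable => //; exact: finite_finset.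
Qed.

Lemma union_bound (I : finType) (Q : pred I) (A : I -> set Omega) (u : I -> R) B :
  measurable B -> (forall i, Q i -> measurable (A i)) ->
  (forall w, B w -> exists2 i, Q i & A i w) ->
  (forall i, Q i -> P (A i) <= (u i)%:E)%E ->
  (P B <= (\sum_(i | Q i) u i)%:E)%E.
Proof.
move=> mB mA BA Au.
have [mU PU] : measurable (\big[setU/set0]_(i | Q i) A i) /\
    (P (\big[setU/set0]_(i | Q i) A i) <= (\sum_(i | Q i) u i)%:E)%E.
  elim/big_rec2: _ => [|i y U Qi [mU PU]]; first by rewrite measure0.
  split; first by apply: measurableU => //; exact: mA.
  rewrite EFinD; apply: le_trans (measureU2 _ (mA _ Qi) mU) _.
  by apply: leeD => //; exact: Au.
apply: le_trans PU; apply: le_measure; rewrite ?inE // => w /BA [i Qi Ai].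
by rewrite -bigcup_seq_cond; exists i => //=; rewrite mem_index_enum.
Qed.

End UnionBound.

Section Cells.
Variable R : realType.

Definition coord (c : cell) (k : 'I_3) : nat := nth 0%N [:: c.1.1; c.1.2; c.2] k.

Definition in_cell (s : R) (m n : nat) (p : 'I_n -> 'I_3 -> R) (i : 'I_n) (c : cell) : Prop :=
  forall k, (coord c k)%:R * (s / m%:R) <= p i k <= (coord c k).+1%:R * (s / m%:R).

Definition gcell (m : nat) := ('I_m * 'I_m * 'I_m)%type.

Definition ncell m (c : gcell m) : cell := (c.1.1 : nat, c.1.2 : nat, c.2 : nat).

Lemma ncell_inj m : injective (@ncell m).
Proof. by move=> [[x y] z] [[x' y'] z'] [] /val_inj -> /val_inj -> /val_inj ->. Qed.

Lemma ncell_in_grid m (c : gcell m) : in_grid m (ncell c).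
Proof. by rewrite /in_grid /= !ltn_ord. Qed.

Lemma in_grid_ncell m c : in_grid m c -> exists c' : gcell m, c = ncell c'.
Proof.
case: c => [[x y] z] /and3P[/= hx hy hz].
by exists (Ordinal hx, Ordinal hy, Ordinal hz).
Qed.

Lemma interval_cell (s x : R) m : (0 < m)%N -> 0 < s -> 0 <= x <= s ->
  exists k : 'I_m, k%:R * (s / m%:R) <= x <= k.+1%:R * (s / m%:R).
Proof.
move=> m0 s0 /andP[x0 xs].
have a0 : 0 < s / m%:R by rewrite divr_gt0 // ltr0n.
have sm : m%:R * (s / m%:R) = s by rewrite mulrC divfK // gt_eqF // ltr0n.
(* The endpoint [s] goes to the last cell; truncation would give it the index [m]. *)
have [xlt|sx] := ltP x s; last first.
  have k1 : (m.-1 < m)%N by rewrite prednK.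
  exists (Ordinal k1) => /=; rewrite prednK // sm xs andbT (le_trans _ sx) //.
  by rewrite -[leRHS]sm ler_pM2r // ler_nat leq_pred.
have y0 : 0 <= x / (s / m%:R) by rewrite divr_ge0 // ltW.
have /andP[t1 t2] := truncn_itv y0.
have km : (Num.truncn (x / (s / m%:R)) < m)%N.
  by rewrite -(ltr_nat R); apply: le_lt_trans t1 _; rewrite ltr_pdivrMr // sm.
exists (Ordinal km) => /=.
by rewrite -ler_pdivlMr // t1 -ler_pdivrMr // ltW.
Qed.

Lemma in_cell_exists (s : R) m n (p : 'I_n -> 'I_3 -> R) i : (0 < m)%N -> 0 < s ->
  (forall k, 0 <= p i k <= s) -> exists c : gcell m, in_cell s m p i (ncell c).
Proof.
move=> m0 s0 ps; have h k := interval_cell m0 s0 (ps k).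
have [x hx] := h ord0; have [y hy] := h (lift ord0 ord0); have [z hz] := h ord_max.
exists (x, y, z) => k.
by case: k => -[|[|[|//]]] hk; [move: hx|move: hy|move: hz];
  congr (is_true (_ <= p i _ <= _)); apply: val_inj.
Qed.

Lemma near_in_cell_dist (s r : R) m n (p : 'I_n -> 'I_3 -> R) i j c c' :
  0 < s -> (0 < m)%N -> 50 * (s / m%:R) <= r -> nearby c c' ->
  in_cell s m p i c -> in_cell s m p j c' -> dist3 (p i) (p j) <= r.
Proof.
move=> s0 m0 sr nr ic jc.
set a := s / m%:R in sr; have a0 : 0 < a by rewrite divr_gt0 // ltr0n.
apply: le_trans sr; rewrite /dist3.
have -> : 50 * a = Num.sqrt ((50 * a) ^+ 2) by rewrite sqrtr_sqr ger0_norm // mulr_ge0 // ltW.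
apply: ler_wsqrtr.
have bnd k : (p i k - p j k) ^+ 2 <= ((absd (coord c k) (coord c' k)).+1%:R * a) ^+ 2.
  have /andP[i1 i2] := ic k; have /andP[j1 j2] := jc k.
  rewrite -!/a in i1 i2 j1 j2.
  have : `|p i k - p j k| <= (absd (coord c k) (coord c' k)).+1%:R * a.
    rewrite ler_norml.
    set u := coord c k in i1 i2 *; set v := coord c' k in j1 j2 *.
    have h1 : u%:R <= v%:R + (absd u v)%:R :> R by rewrite -natrD ler_nat /absd; lia.
    have h2 : v%:R <= u%:R + (absd u v)%:R :> R by rewrite -natrD ler_nat /absd; lia.
    move: i1 i2 j1 j2; rewrite -!natr1 => i1 i2 j1 j2.
    by apply/andP; split; nra.
  move=> h; rewrite -[leLHS]real_normK ?num_real // ler_sqr ?nnegrE //.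
  exact: le_trans h.
rewrite !big_ord_recl big_ord0 addr0.
apply: le_trans (lerD (bnd _) (lerD (bnd _) (bnd _))) _.
clearbody a; rewrite !exprMn -!mulrDl ler_wpM2r ?sqr_ge0 // addrA.
by move: nr; rewrite /nearby -(ler_nat R) !natrD !natrX.
Qed.

End Cells.

Section Avoid.
Variables (R : realType) (d : measure_display) (Omega : measurableType d).
Variables (P : probability Omega R) (n : nat) (s : R) (X : 'I_n -> 'I_3 -> Omega -> R).
Hypotheses (s0 : 0 < s) (iid : iid_uniform_cube P s X).

Lemma measurable_box (a b : 'I_n -> 'I_3 -> R) :
  measurable [set w | forall i k, a i k <= X i k w <= b i k].
Proof.
have -> : [set w | forall i k, a i k <= X i k w <= b i k] =
    ~` [set w | exists2 ik : 'I_n * 'I_3, true &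
        (~` (X ik.1 ik.2 @^-1` `[a ik.1 ik.2, b ik.1 ik.2])) w].
  apply/seteqP; split=> w /=.
    by move=> h [[i k] _] /=; apply; rewrite in_itv /=; exact: h.
  move=> h i k; apply: contrapT => nik; apply: h; exists (i, k); first by [].
  by move=> /=; rewrite in_itv.
apply: measurableC; apply: measurable_finite_exists => -[i k] _ /=.
apply: measurableC; rewrite -[X in measurable X]setTI.
by have [mX _] := iid; exact: (mX i k measurableT _ (measurable_itv _)).
Qed.

Definition in_cube : set Omega := [set w | forall i k, 0 <= X i k w <= s].

Lemma measurable_in_cube : measurable in_cube.
Proof. exact: (measurable_box (fun _ _ => 0) (fun _ _ => s)). Qed.

(** Only the law of the nodes is given, so they lie in the cube almost surely, not surely. *)
Lemma prob_out_cube : P (~` in_cube) = 0%E.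
Proof.
rewrite probability_setC; last exact: measurable_in_cube.
suff -> : P in_cube = 1%E by rewrite subee.
have [_ ->] := iid; rewrite big1 // => i _; rewrite big1 // => k _.
by rewrite setIid lebesgue_measure_itv /= lte_fin s0 oppr0 adde0 /= divff // gt_eqF.
Qed.

Variable m : nat.
Hypothesis m0 : (0 < m)%N.

Definition cell_box (f : {ffun 'I_n -> gcell m}) : set Omega :=
  [set w | forall i k, (coord (ncell (f i)) k)%:R * (s / m%:R) <= X i k w <=
                       (coord (ncell (f i)) k).+1%:R * (s / m%:R)].

Lemma coord_lt (c : gcell m) k : (coord (ncell c) k < m)%N.
Proof. by case: k => -[|[|[|//]]] ?; exact: ltn_ord. Qed.

Lemma prob_cell_box f : P (cell_box f) = ((m%:R ^- 3) ^+ n)%:E.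
Proof.
have a0 : 0 < s / m%:R by rewrite divr_gt0 // ltr0n.
have sm : m%:R * (s / m%:R) = s by rewrite mulrC divfK // gt_eqF // ltr0n.
have [_ ->] := iid; congr EFin.
rewrite (eq_bigr (fun _ => m%:R ^- 3)) ?prodr_const ?card_ord // => i _.
rewrite (eq_bigr (fun _ => m%:R^-1)) ?prodr_const ?card_ord ?exprVn // => k _.
have km := coord_lt (f i) k; set u := coord _ _ in km *.
have -> : `[u%:R * (s / m%:R), u.+1%:R * (s / m%:R)] `&` `[0, s] =
    `[u%:R * (s / m%:R), u.+1%:R * (s / m%:R)]%classic.
  apply/setIidPl => x /=; rewrite !in_itv /= => /andP[h1 h2]; apply/andP; split.
    by apply: le_trans h1; rewrite mulr_ge0 // ltW.
  by apply: le_trans h2 _; rewrite -[leRHS]sm ler_pM2r // ler_nat.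
rewrite lebesgue_measure_itv /= lte_fin ltr_pM2r // ltr_nat ltnSn /= -natr1.
by field; rewrite ?gt_eqF ?ltr0n.
Qed.

(** Expressed by the cells outside [K], this is a finite union of closed boxes, whose probabilities
    are given. Nodes on common faces do no harm: in the cube, if the event fails then a cell of [K]
    is occupied. *)
Definition avoid (K : {set gcell m}) : set Omega :=
  [set w | forall i, exists2 c : gcell m, c \notin K &
           in_cell s m (fun i k => X i k w) i (ncell c)].

Lemma avoidE K : avoid K =
  [set w | exists2 f : {ffun 'I_n -> gcell m}, f \in ffun_on (~: K) & cell_box f w].
Proof.
apply/seteqP; split=> w /=; last first.
  by move=> [f /ffun_onP fK bf] i; exists (f i); [have := fK i; rewrite inE | exact: bf].
move=> h; have h' i : exists c : gcell m,
    c \notin K /\ in_cell s m (fun i k => X i k w) i (ncell c).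
  by have [c] := h i; exists c.
have [f fP] := choice h'; exists (finfun f).
  by apply/ffun_onP => i; rewrite ffunE inE; have [] := fP i.
by move=> i k; rewrite ffunE; have [_] := fP i; apply.
Qed.

Lemma measurable_avoid K : measurable (avoid K).
Proof.
by rewrite avoidE; apply: measurable_finite_exists => f _; exact: measurable_box.
Qed.

(** There are [(m^3 - #|K|)^n] placements outside [K], each of probability [m^(-3n)]; then
    [1 - x <= exp (- x)]. *)
Lemma prob_avoid K : (P (avoid K) <= (expR (- (n%:R / m%:R ^+ 3 * #|K|%:R)))%:E)%E.
Proof.
apply: (@le_trans _ _ (\sum_(f : {ffun 'I_n -> gcell m} | f \in ffun_on (~: K))
   ((m%:R ^- 3) ^+ n : R))%:E).
  apply: (@union_bound _ _ _ _ _ _ cell_box); first exact: measurable_avoid.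
  - by move=> f _; exact: measurable_box.
  - by move=> w; rewrite avoidE.
  - by move=> f _; rewrite prob_cell_box.
rewrite lee_fin big_const iter_addr_0 (_ : #|_| = (#|~: K| ^ #|'I_n|)%N); last first.
  exact: card_ffun_on.
have m3 : 0 < m%:R ^+ 3 :> R by rewrite exprn_gt0 // ltr0n.
have cK : #|~: K|%:R = m%:R ^+ 3 - #|K|%:R :> R.
  rewrite -natrX -(_ : #|{: 'I_m * 'I_m * 'I_m}| = m ^ 3)%N; last first.
    by rewrite !card_prod !card_ord !expnS expn0; lia.
  by rewrite -(cardsC K) natrD addrC addKr.
rewrite card_ord -[leLHS]mulr_natl natrX -exprMn cK mulrBl divff ?gt_eqF //.
have -> : - (n%:R / m%:R ^+ 3 * #|K|%:R) = n%:R * - (#|K|%:R / m%:R ^+ 3) :> R.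
  by field; rewrite gt_eqF // ltr0n.
rewrite expRM_natl; apply: lerXn2r; rewrite ?nnegrE ?expR_ge0 ?expR_ge1Dx //.
by rewrite -[X in X - _](divff (x := m%:R ^+ 3)) ?gt_eqF // -mulrBl -cK divr_ge0 // ltW.
Qed.

Lemma not_avoid_occ K w : in_cube w -> ~ avoid K w ->
  exists2 c : gcell m, c \in K & occ (in_cell s m (fun i k => X i k w)) (ncell c).
Proof.
move=> cw; apply: contra_notP => nK i.
have [c ic] := @in_cell_exists _ s m n (fun i k => X i k w) i m0 s0 (cw i).
by exists c => //; apply/negP => cK; apply: nK; exists c => //; exists i.
Qed.

End Avoid.

(** * Sizes of caps and blocks *)

Section Regions.
Variable m : nat.
Implicit Types c b : gcell m.

Definition cap c : {set gcell m} :=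
  [set c' : gcell m | (c.1.1 < c'.1.1)%N && nearby (ncell c) (ncell c')].

Definition gmirror c : gcell m := (rev_ord c.1.1, c.1.2, c.2).

(** Here [c] is a cell of the mirrored grid, so that the same condition on [c.1.1] serves both
    directions. *)
Definition back_cap c : {set gcell m} := gmirror @: cap c.

Definition block b (L : nat) : {set gcell m} :=
  [set c : gcell m | in_block (ncell b) L (ncell c)].

Lemma ncell_gmirror c : ncell (gmirror c) = mirror m (ncell c).
Proof. by congr (_, _, _); rewrite /=; lia. Qed.

Lemma gmirror_inj : injective gmirror.
Proof.
move=> [[x y] z] [[x' y'] z'] [] ex -> ->; congr (_, _, _); apply: val_inj => /=.
by have := ltn_ord x; have := ltn_ord x'; lia.
Qed.

Lemma card_back_cap c : #|back_cap c| = #|cap c|.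
Proof. exact: card_imset gmirror_inj. Qed.

Lemma card_ord_interval a L : (#|[set x : 'I_m | (a <= x < a + L)%N]%SET| <= L)%N.
Proof.
rewrite cardE -(size_map val) -[leqRHS](size_iota a); apply: uniq_leq_size.
  by rewrite map_inj_uniq ?enum_uniq //; exact: val_inj.
by move=> _ /mapP[x + ->]; rewrite mem_enum inE mem_iota.
Qed.

Lemma card_block b L : (#|block b L| <= L ^ 3)%N.
Proof.
pose I (a : nat) := [set x : 'I_m | (a <= x < a + L)%N]%SET.
have -> : block b L = finset.setX (finset.setX (I b.1.1) (I b.1.2)) (I b.2).
  by apply/finset.setP => -[[x y] z]; rewrite !inE /in_block /= andbA.
by rewrite !cardsX !expnS expn0 muln1 mulnA !leq_mul // card_ord_interval.
Qed.

(* For [100 <= m], the number of directions along an axis in which 50 more cells remain. *)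
Definition sides (y : nat) : nat := ((50 <= y)%N && (y + 50 <= m)%N).+1%N.

Definition open_side (y : nat) (up : bool) : bool :=
  if up then (y + 50 <= m)%N else (50 <= y)%N.

Definition shift (y j : nat) (up : bool) : nat := if up then (y + j)%N else (y - j)%N.

Lemma sides_le y : (100 <= m)%N -> (sides y <= #|[set up | open_side y up]%SET|)%N.
Proof.
move=> m100; rewrite -sum1dep_card big_mkcond big_bool /sides /open_side /=.
by case: (leqP 50 y); case: (leqP (y + 50) m) => /=; lia.
Qed.

Lemma shift_lt y j up : open_side y up -> (y < m)%N -> (j < 50)%N -> (shift y j up < m)%N.
Proof. by case: up; rewrite /open_side /shift; lia. Qed.

Lemma absd_shift y j up : open_side y up -> (j < 50)%N -> absd y (shift y j up) = j.
Proof. by case: up; rewrite /open_side /shift /absd; lia. Qed.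

Lemma shift_inj y j up j' up' : open_side y up -> open_side y up' ->
  (0 < j < 50)%N -> (0 < j' < 50)%N -> shift y j up = shift y j' up' -> j = j' /\ up = up'.
Proof. by case: up; case: up'; rewrite /open_side /shift => *; split; try lia; exfalso; lia. Qed.

(** The cap contains one copy of [octant] for each choice of an open side on the second and on the
    third axis. Copies are disjoint because the displacements are nonzero. *)
Lemma card_cap c : (100 <= m)%N -> (c.1.1 + 50 <= m)%N ->
  (#|octant| * (sides c.1.2 * sides c.2) <= #|cap c|)%N.
Proof.
case: c => [[x y] z] /= m100 xm.
pose S (u : nat) := [set up | open_side u up]%SET.
pose D : {set ('I_50 * 'I_50 * 'I_50) * (bool * bool)} := finset.setX octant (finset.setX (S y) (S z)).
pose g (v : ('I_50 * 'I_50 * 'I_50) * (bool * bool)) : gcell m :=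
  (insubd x (x + v.1.1.1)%N, insubd y (shift y v.1.1.2 v.2.1), insubd z (shift z v.1.2 v.2.2)).
apply: (@leq_trans #|D|).
  by rewrite !cardsX leq_mul2l; apply/orP; right; apply: leq_mul; exact: sides_le.
have gE v : v \in D -> ncell (g v) =
    ((x + v.1.1.1)%N, shift y v.1.1.2 v.2.1, shift z v.1.2 v.2.2).
  case: v => [[[i j] k] [a b]]; rewrite !inE /= => /and3P[_ ya zb].
  rewrite /ncell /g /= !val_insubd !shift_lt // ifT //.
  by have := ltn_ord i; lia.
have inj : {in D &, injective g}.
  move=> v v' vD v'D /(congr1 (@ncell m)); rewrite !gE //.
  case: v vD => [[[i j] k] [a b]]; case: v' v'D => [[[i' j'] k'] [a' b']].
  rewrite !inE /= => /and3P[/and4P[_ j0' k0' _] ya' zb'] /and3P[/and4P[_ j0 k0 _] ya zb] [ei ey ez].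
  have [|| ej ->] := shift_inj ya ya' _ _ ey; rewrite ?j0 ?j0' ?ltn_ord //.
  have [|| ek ->] := shift_inj zb zb' _ _ ez; rewrite ?k0 ?k0' ?ltn_ord //.
  by congr (_, _, _, _); apply: val_inj => //=; lia.
rewrite -(card_in_imset inj); apply: subset_leq_card; apply/fintype.subsetP => _ /imsetP[v vD ->].
have vE := gE _ vD; case: v vD vE => [[[i j] k] [a b]].
rewrite !inE /= => /and3P[/and4P[i0 j0 k0 oct] ya zb] vE.
have x1 : (g (i, j, k, (a, b))).1.1 = (x + i)%N :> nat by case: vE.
apply/andP; split; first by rewrite -[X in (_ < X)%N]/(nat_of_ord _) x1; lia.
rewrite vE /nearby /= !absd_shift //.
by have -> : absd x (x + i) = i by rewrite /absd; lia.
Qed.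

End Regions.

(** * Summing the cap bounds over the grid *)

Section CapSum.
Variables (R : realType) (m : nat) (t : R).
Hypothesis t0 : 0 <= t.

Lemma card_one_sided :
  (#|[set y : 'I_m | ~~ ((50 <= y) && (y + 50 <= m))]%SET| <= 100)%N.
Proof.
pose I a := [set y : 'I_m | (a <= y < a + 50)%N]%SET.
apply: (@leq_trans #|I 0%N :|: I (m - 50)%N|%SET).
  apply: subset_leq_card; apply/fintype.subsetP => y; rewrite !inE.
  by have := ltn_ord y; lia.
apply: leq_trans (leq_card_setU _ _) _.
by apply: (@leq_add _ _ 50 50); exact: card_ord_interval.
Qed.

Lemma sum_sides : \sum_(y < m) expR (- (t * (sides m y)%:R)) <=
  100 * expR (- t) + m%:R * expR (- t) ^+ 2.
Proof.
pose A := [set y : 'I_m | ~~ ((50 <= y) && (y + 50 <= m))%N]%SET.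
apply: (@le_trans _ _ (\sum_(y < m) ((y \in A)%:R * expR (- t) + expR (- t) ^+ 2))).
  apply: ler_sum => y _; rewrite inE /sides -expRM_natl.
  case: (_ && _) => /=; rewrite ?mul0r ?add0r ?mul1r ?mulr1.
    by rewrite mulrN mulrC.
  by rewrite lerDl expR_ge0.
rewrite big_split /= sumr_const card_ord -[X in _ + X]mulr_natl lerD2r -mulr_suml.
rewrite ler_pM2r ?expR_gt0 // -natr_sum ler_nat.
rewrite (eq_bigr (fun y => if y \in A then 1%N else 0%N)); last by move=> y _; case: (_ \in _).
by rewrite -big_mkcond sum1_card; exact: card_one_sided.
Qed.

(** With [p] and [q] the numbers of sides, [(p - 1) (q - 1) >= 0] gives [p q >= p + q - 1]. The sum
    is thus at most [m * expR t] times the square of the sum in [sum_sides]. *)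
Lemma sum_caps :
  \sum_(c : gcell m) expR (- (t * (sides m c.1.2 * sides m c.2)%:R)) <=
  (m%:R * expR (- t)) * (100 + m%:R * expR (- t)) ^+ 2.
Proof.
set S := \sum_(y < m) expR (- (t * (sides m y)%:R)).
have S0 : 0 <= S by apply: sumr_ge0 => y _; exact: expR_ge0.
apply: (@le_trans _ _ (m%:R * expR t * S ^+ 2)); last first.
  have -> : m%:R * expR (- t) * (100 + m%:R * expR (- t)) ^+ 2 =
      m%:R * expR t * (100 * expR (- t) + m%:R * expR (- t) ^+ 2) ^+ 2.
    have e1 : expR t * expR (- t) = 1 by exact: expRxMexpNx_1.
    set u := expR (- t) in e1 *; set v := expR t in e1 *.
    have -> : m%:R * v * (100 * u + m%:R * u ^+ 2) ^+ 2 =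
      (v * u) * (m%:R * u * (100 + m%:R * u) ^+ 2) by ring.
    by rewrite e1 mul1r.
  apply: ler_wpM2l; first by rewrite mulr_ge0 // expR_ge0.
  by rewrite ler_sqr ?nnegrE ?sum_sides // (le_trans S0) ?sum_sides.
rewrite [leLHS](_ : _ = \sum_(x < m) \sum_(y < m) \sum_(z < m)
    expR (- (t * (sides m y * sides m z)%:R))); last by rewrite !pair_bigA.
rewrite sumr_const card_ord -[leLHS]mulr_natl -mulrA ler_wpM2l //.
rewrite expr2 mulr_suml mulr_sumr; apply: ler_sum => y _.
rewrite !mulr_sumr; apply: ler_sum => z _.
rewrite -!expRD ler_expR natrM.
have s1 (u : nat) : 0 <= (sides m u)%:R - 1 :> R by rewrite subr_ge0 ler1n.
have := mulr_ge0 t0 (mulr_ge0 (s1 y) (s1 z)).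
move: ((sides m y)%:R : R) ((sides m z)%:R : R) => p q h.
by rewrite -subr_ge0; apply: le_trans h _; rewrite le_eqVlt; apply/orP; left; apply/eqP; ring.
Qed.

End CapSum.

(** * Bad events and their probabilities *)

Section Bad.
Variables (R : realType) (d : measure_display) (Omega : measurableType d).
Variables (P : probability Omega R) (n : nat) (s : R) (X : 'I_n -> 'I_3 -> Omega -> R).
Hypotheses (s0 : 0 < s) (iid : iid_uniform_cube P s X).
Variables (m L k0 : nat).
Hypothesis m100 : (100 <= m)%N.

Let m0 : (0 < m)%N. Proof. exact: leq_trans m100. Qed.
Let avoid := @avoid R d Omega n s X m.
Let inc w := in_cell s m (fun i k => X i k w).

Definition bad_block : set Omega :=
  [set w | exists2 bK : gcell m * {set gcell m},
    (bK.2 \subset block bK.1 L) && (#|bK.2| == k0.+1) & avoid bK.2 w].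

Definition bad_cap (K : gcell m -> {set gcell m}) : set Omega :=
  [set w | exists2 c : gcell m, (c.1.1 + 50 <= m)%N & avoid (K c) w].

Lemma measurable_bad_block : measurable bad_block.
Proof. by apply: measurable_finite_exists => i _; exact: (measurable_avoid iid). Qed.

Lemma measurable_bad_cap K : measurable (bad_cap K).
Proof. by apply: measurable_finite_exists => i _; exact: (measurable_avoid iid). Qed.

(** There are [m^3] corners, and at most [2^(L^3)] sets of cells in each block. *)
Lemma prob_bad_block : (P bad_block <=
  ((2 ^ (L ^ 3))%:R * (m%:R ^+ 3 * expR (- (n%:R / m%:R ^+ 3 * k0.+1%:R))))%:E)%E.
Proof.
set u := expR _.
apply: (@le_trans _ _ (\sum_(bK : gcell m * {set gcell m} |
    (bK.2 \subset block bK.1 L) && (#|bK.2| == k0.+1)) u)%:E).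
  apply: (@union_bound _ _ _ _ _ _ (fun bK => avoid bK.2)) => //.
  - exact: measurable_bad_block.
  - by move=> i _; exact: (measurable_avoid iid).
  - by move=> i /andP[_ /eqP c]; have := prob_avoid s0 iid m0 i.2; rewrite c.
rewrite lee_fin big_const iter_addr_0 -[leLHS]mulr_natl mulrA ler_wpM2r ?expR_ge0 //.
rewrite -natrX -natrM ler_nat -sum1_card.
rewrite [leqLHS](_ : _ = \sum_(b : gcell m)
    \sum_(K : {set gcell m} | (K \subset block b L) && (#|K| == k0.+1)) 1)%N; last first.
  by rewrite pair_big_dep.
apply: (@leq_trans (\sum_(b : gcell m) 2 ^ (L ^ 3))%N); last first.
  by rewrite sum_nat_const !card_prod !card_ord !expnS expn0; lia.
apply: leq_sum => b _; rewrite sum1_card.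
apply: (@leq_trans #|powerset (block b L)|).
  by apply: subset_leq_card; apply/fintype.subsetP => K; rewrite powersetE => /andP[].
by rewrite card_powerset leq_exp2l // card_block.
Qed.

Let xi : R := m%:R * expR (- (n%:R / m%:R ^+ 3 * #|octant|%:R)).

Lemma prob_bad_cap (K : gcell m -> {set gcell m}) : (forall c, #|K c| = #|cap c|) ->
  (P (bad_cap K) <= (xi * (100 + xi) ^+ 2)%:E)%E.
Proof.
move=> cK; have th0 : 0 <= n%:R / m%:R ^+ 3 :> R by rewrite divr_ge0 // exprn_ge0.
rewrite /xi; set t : R := n%:R / m%:R ^+ 3 * #|octant|%:R.
have t0 : 0 <= t by rewrite mulr_ge0.
apply: (@le_trans _ _ (\sum_(c : gcell m | (c.1.1 + 50 <= m)%N)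
    expR (- (t * (sides m c.1.2 * sides m c.2)%:R)))%:E).
  apply: (@union_bound _ _ _ _ _ _ (fun c => avoid (K c))) => //.
  - exact: measurable_bad_cap.
  - by move=> i _; exact: (measurable_avoid iid).
  - move=> c hc; apply: le_trans (prob_avoid s0 iid m0 (K c)) _.
    rewrite lee_fin ler_expR lerN2 cK.
    rewrite [leLHS](_ : _ = n%:R / m%:R ^+ 3 *
      (#|octant| * (sides m c.1.2 * sides m c.2))%:R); last by rewrite /t !natrM !mulrA.
    rewrite ler_wpM2l // ler_nat.
    exact: card_cap.
rewrite lee_fin; apply: le_trans (sum_caps m t0).
by rewrite [leRHS](bigID (fun c : gcell m => (c.1.1 + 50 <= m)%N)) /= lerDl sumr_ge0 // => c _;
  exact: expR_ge0.
Qed.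

Lemma few_empty_of_good w : in_cube s X w -> ~ bad_block w -> few_empty (inc w) m L k0.
Proof.
move=> cw nb b S uS sS /allP aS.
pose K : {set gcell m} := [set c : gcell m | ncell c \in S]%SET.
(* A grid cell in the block forces its corner [b] into the grid, hence among the corners counted in
   [bad_block]. *)
have [c0 c0S] : exists c0, c0 \in S by case: S sS {uS aS K} => // c0 S _; exists c0; rewrite inE eqxx.
have bg : in_grid m b.
  have /andP[/and3P[h1 h2 h3] /and3P[h4 h5 h6]] := aS _ c0S.
  by apply/and3P; split; lia.
have [b' bE] := in_grid_ncell bg.
have cK : #|K| = k0.+1.
  rewrite -sS cardE -(size_map (@ncell m)); apply/perm_size/uniq_perm => //.
    by rewrite map_inj_uniq ?enum_uniq //; exact: ncell_inj.
  move=> c; apply/mapP/idP => [[c' + ->]|cS]; first by rewrite mem_enum inE.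
  have /andP[/in_grid_ncell[c' cE] _] := aS _ cS.
  by exists c' => //; rewrite mem_enum inE -cE.
have [|c cinK oc] := @not_avoid_occ _ _ _ _ s X s0 m m0 K w cw.
  move=> aK; apply: nb; exists (b', K) => //=; rewrite cK eqxx andbT.
  apply/fintype.subsetP => c; rewrite !inE => /aS /andP[_]; by rewrite bE.
by exists (ncell c) => //; move: cinK; rewrite inE.
Qed.

Lemma forward_step_of_good w : in_cube s X w -> ~ bad_cap (@cap m) w ->
  forward_step (inc w) m.
Proof.
move=> cw nb c /in_grid_ncell[c' ->] /= hc.
have [|c1] := @not_avoid_occ _ _ _ _ s X s0 m m0 (cap c') w cw.
  by move=> aK; apply: nb; exists c'.
rewrite inE => /andP[lt nr] oc; exists (ncell c1); split=> //.
exact: ncell_in_grid.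
Qed.

Lemma backward_step_of_good w : in_cube s X w -> ~ bad_cap (@back_cap m) w ->
  forward_step (mirror_inc m (inc w)) m.
Proof.
move=> cw nb c /in_grid_ncell[c' ->] /= hc.
have [|c1] := @not_avoid_occ _ _ _ _ s X s0 m m0 (back_cap c') w cw.
  by move=> aK; apply: nb; exists c'.
move=> /imsetP[c2 + ->]; rewrite inE => /andP[lt nr] [i]; rewrite ncell_gmirror => ic.
exists (ncell c2); split=> //; first exact: ncell_in_grid.
by exists i; split=> //=; exact: ltn_ord.
Qed.

End Bad.

(** * Measurability of graph events, and bounding the diameter by [reach] *)

Section Event.
Variables (R : realType) (d : measure_display) (Omega : measurableType d).
Variables (n : nat) (X : 'I_n -> 'I_3 -> Omega -> R).
Hypothesis mX : forall i k, measurable_fun setT (X i k).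

Let adj (r : R) (w : Omega) : rel 'I_n := rgg_adj (fun i k => X i k w) r.

Lemma measurable_dist_le r i j :
  measurable [set w | dist3 (fun k => X i k w) (fun k => X j k w) <= r].
Proof.
have [r0|r0] := ltP r 0.
  rewrite [X in measurable X](_ : _ = set0) //; apply/seteqP; split=> // w /= h.
  by have := le_lt_trans h r0; rewrite ltNge sqrtr_ge0.
pose S w := \sum_(k < 3) (X i k w - X j k w) ^+ 2.
have mS : measurable_fun setT S.
  apply: measurable_sum => k; apply: measurable_funX; exact: measurable_funB.
rewrite [X in measurable X](_ : _ = setT `&` S @^-1` `]-oo, r ^+ 2]); last first.
  rewrite setTI; apply/seteqP; split=> w /=; rewrite /dist3 -/(S w) in_itv /=.
    move=> h; rewrite -[S w]sqr_sqrtr ?ler_sqr ?nnegrE ?sqrtr_ge0 //.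
    by apply: sumr_ge0 => k _; exact: sqr_ge0.
  by move=> h; rewrite -(ger0_norm r0) -sqrtr_sqr ler_wsqrtr.
exact: mS.
Qed.

Lemma measurable_adj r i j b : measurable [set w | adj r w i j = b].
Proof.
have mt : measurable [set w | adj r w i j].
  rewrite /adj /rgg_adj; case: (i != j) => /=; last by rewrite set_false.
  exact: measurable_dist_le.
case: b => //; rewrite [X in measurable X](_ : _ = ~` [set w | adj r w i j]).
  exact: measurableC.
by apply/seteqP; split=> w /=; [move=> -> | move/negP/negbTE].
Qed.

(** There are finitely many graphs on [n] nodes, and equality with a given one is a finite
    intersection of adjacency events. *)
Lemma measurable_graph_event r (Q : rel 'I_n -> Prop) :
  measurable [set w | Q (adj r w)].
Proof.
pose of_ffun (F : {ffun 'I_n * 'I_n -> bool}) : rel 'I_n := fun i j => F (i, j).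
rewrite [X in measurable X](_ : _ = [set w | exists2 F, `[< Q (of_ffun F) >] &
   (~` [set w | exists2 ij : 'I_n * 'I_n, true &
        (~` [set w | adj r w ij.1 ij.2 = of_ffun F ij.1 ij.2]) w]) w]).
  apply: measurable_finite_exists => F _; apply: measurableC.
  by apply: measurable_finite_exists => ij _; apply: measurableC; exact: measurable_adj.
apply/seteqP; split=> w /=.
  move=> Qw; pose F : {ffun 'I_n * 'I_n -> bool} := [ffun ij => adj r w ij.1 ij.2].
  have FE : of_ffun F = adj r w.
    by apply/funext => i; apply/funext => j; rewrite /of_ffun ffunE.
  by exists F; [apply/asboolP; rewrite FE | rewrite FE => -[ij _]; apply].
move=> [F /asboolP QF nF]; suff -> : adj r w = of_ffun F by [].
apply/funext => i; apply/funext => j; apply: contrapT => ne; apply: nF.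
by exists (i, j).
Qed.

Lemma hop_diameter_le (e : rel 'I_n) (b : R) : 0 <= b ->
  (forall i j, exists2 k, reach e k i j & k%:R <= b) -> (@hop_diameter R n e <= b%:E)%E.
Proof.
move=> b0 h; have b0' : (0 <= b%:E)%E by rewrite lee_fin.
apply: bigmax_le => // i _; apply: bigmax_le => // j _.
have [k [s [ps ls zs]] kb] := h i j.
apply: (@le_trans _ _ (size s)%:R%:E).
  by apply: ereal_inf_lbound; exists (size s) => //; exists s.
by rewrite lee_fin (le_trans _ kb) // ler_nat.
Qed.

Lemma rgg_adj_sym r w : symmetric (adj r w).
Proof.
move=> i j; rewrite /adj /rgg_adj eq_sym /dist3.
by congr (_ && (Num.sqrt _ <= _)); apply: eq_bigr => k _; rewrite -sqrrN opprB.
Qed.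

End Event.

(** * The probability bound for a fixed number of nodes *)

Section Diameter.
Variables (R : realType) (d : measure_display) (Omega : measurableType d).
Variables (P : probability Omega R) (n : nat) (s : R) (X : 'I_n -> 'I_3 -> Omega -> R).
Hypotheses (s0 : 0 < s) (iid : iid_uniform_cube P s X).

(** With this [k0] the block bound is a constant times [xi ^+ 3], so [xi] alone controls all
    errors. *)
Lemma prob_hop_diameter (m : nat) (r b : R) (k0 := (3 * #|octant|)%N)
    (xi := m%:R * expR (- (n%:R / m%:R ^+ 3 * #|octant|%:R)) : R) :
  (100 <= m)%N -> (grid_min k0 <= m)%N -> 50 * (s / m%:R) <= r ->
  3 * (m%:R - 1) <= 25 * b -> 
  ((1 - ((2 ^ ((40 * block_len k0) ^ 3))%:R * xi ^+ 3 + 2 * (xi * (100 + xi) ^+ 2)))%:E <=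
    P [set w | (@hop_diameter R n (rgg_adj (fun i k => X i k w) r) <= b%:E)%E])%E.
Proof.
move=> m100 mM sr mb; have m0 : (0 < m)%N by apply: leq_trans m100.
set E := [set w | _]; set L := (40 * block_len k0)%N.
have [mX _] := iid.
have mE : measurable E.
  exact: (measurable_graph_event mX r (fun e => (hop_diameter R e <= b%:E)%E)).
have b0 : 0 <= b.
  by have : 1 <= m%:R :> R; [rewrite ler1n | lra].
pose B1 := bad_block s X m L k0.
pose B2 := bad_cap s X (@cap m); pose B3 := bad_cap s X (@back_cap m).
have sub : ~` E `<=` ~` in_cube s X `|` (B1 `|` (B2 `|` B3)).
  move=> w nE; apply: contrapT => /not_orP[/contrapT cw /not_orP[n1 /not_orP[n2 n3]]].
  apply: nE; apply: hop_diameter_le => // i j.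
  have few := few_empty_of_good s0 m100 cw n1.
  have fwd := forward_step_of_good s0 m100 cw n2.
  have bwd := backward_step_of_good s0 m100 cw n3.
  have adj : near_adjacent (rgg_adj (fun i k => X i k w) r) (in_cell s m (fun i k => X i k w)).
    move=> i1 j1 c c' nr ic jc; have [->|ne] := eqVneq i1 j1; [by left|right].
    by rewrite /rgg_adj ne; exact: near_in_cell_dist nr ic jc.
  have [|k rk km] := grid_reach (rgg_adj_sym X r w) adj few fwd bwd mM i j.
    move=> i1; have [c ic] := in_cell_exists (p := fun i k => X i k w) m0 s0 (cw i1).
    by exists (ncell c) => //; exact: ncell_in_grid.
  exists k => //; move: km; rewrite -(ler_nat R) natrD !natrM; lra.
have m1 : measurable (~` in_cube s X) by apply: measurableC; exact: (measurable_in_cube iid).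
have m2 : measurable B1 by exact: (measurable_bad_block iid).
have m3 : measurable B2 by exact: (measurable_bad_cap iid).
have m4 : measurable B3 by exact: (measurable_bad_cap iid).
have m34 := measurableU _ _ m3 m4; have m234 := measurableU _ _ m2 m34.
have PE : (P (~` E) <= ((2 ^ (L ^ 3))%:R * xi ^+ 3 + 2 * (xi * (100 + xi) ^+ 2))%:E)%E.
  apply: (@le_trans _ _ (P (~` in_cube s X `|` (B1 `|` (B2 `|` B3))))).
    by apply: le_measure; rewrite ?inE //; [exact: measurableC | exact: measurableU].
  apply: le_trans (measureU2 _ m1 m234) _; rewrite [X in (X + _)%E](prob_out_cube s0 iid) add0e.
  apply: le_trans (measureU2 _ m2 m34) _; rewrite EFinD; apply: leeD.
    apply: le_trans (prob_bad_block s0 iid L k0 m100) _; rewrite lee_fin ler_wpM2l //.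
    rewrite /xi exprMn ler_wpM2l ?exprn_ge0 // -expRM_natl ler_expR mulrN lerN2.
    rewrite mulrCA -natrM ler_wpM2l ?divr_ge0 ?exprn_ge0 // ler_nat.
    exact: leqnSn.
  apply: le_trans (measureU2 _ m3 m4) _; rewrite mulr2n mulrDl mul1r EFinD; apply: leeD.
    exact: (prob_bad_cap s0 iid m100).
  by apply: (prob_bad_cap s0 iid m100) => c; exact: card_back_cap.
rewrite -[E]setCK probability_setC; last exact: measurableC.
by rewrite EFinB leeB.
Qed.

End Diameter.

(** * Asymptotics *)

(** For the series of [- cos x], the terms after the first three pair up into positive sums, since
    [x <= 2]. *)
Lemma cos_lt_taylor4 (R : realType) (x : R) : 0 < x <= 2 ->
  cos x < 1 - x ^+ 2 / 2 + x ^+ 4 / 24.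
Proof.
move=> /andP[x0 x2]; have /cvgN h := @cvg_cos_coeff' R x.
rewrite -[ltLHS]opprK -(cvg_lim (@Rhausdorff R) h) ltrNl.
apply: (@le_lt_trans _ _ (\sum_(0 <= i < 3) - cos_coeff' x i)).
  do 3 rewrite big_nat_recl//; rewrite big_nil addr0 /cos_coeff' /= !factS fact0.
  rewrite -!exprnP; lra.
rewrite -seriesN lt_sum_lim_series //.
  by move/cvgP in h; rewrite seriesN.
move=> d; rewrite /cos_coeff' -!exprnP.
have -> : (3 + d.*2.+1 = (d + 2) * 2)%N by lia.
have -> : (3 + d.*2 = ((d + 1) * 2).+1)%N by lia.
rewrite exprS !(mulnC _ 2) !exprM sqrrN expr1n !expr1n mulN1r !mul1r !mulNr opprK subr_gt0.
set k := (2 * (d + 1)).+1.*2.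
have -> : ((2 * (d + 2)).*2 = k.+2)%N by rewrite /k; lia.
have : (6 <= k)%N by rewrite /k; lia.
move: k => k; rewrite -(ler_nat R) => k6.
rewrite !factS !exprS !natrM ltr_pdivrMr; last by rewrite -!natrM ltr0n -!factS fact_gt0.
have f0 : 0 < (k`!)%:R :> R by rewrite ltr0n fact_gt0.
have xk : 0 < x ^+ k by rewrite exprn_gt0.
rewrite [ltRHS](_ : _ = x ^+ k * ((k.+2)%:R * (k.+1)%:R)); last first.
  by field; rewrite gt_eqF.
rewrite mulrA mulrC ltr_pM2l // -!natr1; nra.
Qed.

(** The Taylor bound makes [cos (8 / 5)] negative, so [8 / 5] exceeds [pi / 2]. *)
Lemma pi_lt_16_5 (R : realType) : pi < 16 / 5 :> R.
Proof.
have h := @cos_lt_taylor4 R (8 / 5).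
rewrite ltNge; apply/negP => p; have c0 : 0 <= cos (8 / 5 : R).
  by apply: cos_ge0_pihalf; lra.
suff : cos (8 / 5 : R) < 0 by lra.
by apply: lt_trans (h _) _; lra.
Qed.

Section Asymptotics.
Variable R : realType.

Lemma cube_powR3V (x : R) : 0 <= x -> (x `^ (3^-1)) ^+ 3 = x.
Proof. by move=> x0; rewrite -powR_mulrn ?powR_ge0 // -powRrM mulVf // powRr1. Qed.

Lemma powR3V_cube (x : R) : 0 <= x -> (x ^+ 3) `^ (3^-1) = x.
Proof. by move=> x0; rewrite -powR_mulrn // -powRrM mulfV // powRr1. Qed.

Lemma ln_nat_large (K : R) : \forall n \near \oo, K <= ln (n%:R : R).
Proof.
apply: filterS (nbhs_infty_ger (expR K)) => n h.
by rewrite -[K]expRK ler_ln ?posrE ?expR_gt0 // (lt_le_trans _ h) ?expR_gt0.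
Qed.

Lemma nat_div_ln_large (K : R) : \forall n \near \oo, K <= n%:R / ln (n%:R : R).
Proof.
near=> n.
have n1 : 1 < n%:R :> R by rewrite ltr1n; near: n; exact: nbhs_infty_ge.
have nK : 4 * K ^+ 2 <= n%:R by near: n; exact: nbhs_infty_ger.
pose y : R := Num.sqrt n%:R.
have y0 : 0 < y by rewrite sqrtr_gt0; lra.
have yE : n%:R = y ^+ 2 by rewrite sqr_sqrtr //; lra.
have l0 : 0 < ln (n%:R : R) by exact: ln_gt0.
rewrite ler_pdivlMr //.
have [K0|K0] := leP K 0; first by rewrite (le_trans (mulr_le0_ge0 K0 (ltW l0))) //; lra.
have Ky : 2 * K <= y.
  rewrite -ler_sqr ?nnegrE; [|lra|lra].
  by rewrite -yE; lra.
have : ln (n%:R : R) <= 2 * y.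
  by rewrite yE lnXn // -[leLHS]mulr_natl ler_pM2l // ltW // ln_sublinear.
by rewrite yE => h; nra.
Unshelve. all: by end_near. Qed.

(** An octant has mass about [3/4 * 9/20 = 27/80] times [ln n]; rounding [50 * q] up lowers this to
    no less than [42/125], which exceeds [1/3] by [1/375]. The [1/3] is consumed by [m], at most
    [51 * n^(1/3)]. *)
Lemma xi_le (n : nat) (A q : R) (m := (Num.truncn (50 * q)).+1) :
  (1 < n)%N -> 3 / 4 <= A -> 20 <= q -> 1 <= A * ln (n%:R : R) ->
  q ^+ 3 = n%:R / (A * ln n%:R) ->
  m%:R * expR (- (n%:R / m%:R ^+ 3 * #|octant|%:R)) <= 51 * expR (- (ln (n%:R : R) / 375)) :> R.
Proof.
move=> n1 A34 q20 Al qE.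
have n0 : 0 < n%:R :> R by rewrite ltr0n ltnW.
have l0 : 0 < ln (n%:R : R) by rewrite ln_gt0 // ltr1n.
set lam := ln n%:R in Al qE l0 *.
have q0 : 0 < q by lra.
have m1 : m%:R <= 1001 / 20 * q.
  have /andP[t1 _] := @truncn_itv R (50 * q) ltac:(lra).
  by rewrite /m -natr1; lra.
have m0 : 0 < m%:R :> R by rewrite ltr0n.
have qle : q <= expR (lam / 3).
  have eE : expR (lam / 3) ^+ 3 = n%:R by rewrite -expRM_natl mulrC divfK // lnK ?posrE.
  rewrite -(@ler_pXn2r _ 3) ?nnegrE ?expR_ge0 ?(ltW q0) // eE qE ler_pdivrMr; last lra.
  by rewrite ler_peMr // (ltW n0).
have noct : 9 / 20 * 50 ^+ 3 <= #|octant|%:R :> R.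
  have := card_octant; rewrite -(ler_nat R) !natrM.
  by move: (#|octant|%:R : R) => N; lra.
have m3 : m%:R ^+ 3 * (A * lam) <= (1001 / 20) ^+ 3 * n%:R.
  have -> : n%:R = q ^+ 3 * (A * lam) by rewrite qE divfK // gt_eqF //; lra.
  rewrite [leRHS]mulrA -exprMn ler_wpM2r //; first lra.
  by rewrite ler_pXn2r // nnegrE; nra.
have key : 42 / 125 * lam <= n%:R / m%:R ^+ 3 * #|octant|%:R.
  apply: (@le_trans _ _ (n%:R / m%:R ^+ 3 * (9 / 20 * 50 ^+ 3))); last first.
    by rewrite ler_wpM2l // divr_ge0 // ltW // exprn_gt0.
  rewrite [leRHS]mulrAC ler_pdivlMr ?exprn_gt0 //.
  have ml : m%:R ^+ 3 * lam * (3 / 4) <= m%:R ^+ 3 * (A * lam).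
    rewrite (_ : m%:R ^+ 3 * (A * lam) = m%:R ^+ 3 * lam * A); last by ring.
    by rewrite ler_wpM2l // mulr_ge0 ?exprn_ge0 // ltW.
  lra.
apply: (@le_trans _ _ (51 * expR (lam / 3) * expR (- (42 / 125 * lam)))).
  apply: ler_pM; rewrite ?expR_ge0 ?(ltW m0) ?ler_expR ?lerN2 //.
  have := expR_gt0 (lam / 3); lra.
by rewrite -mulrA -expRD ler_wpM2l // ler_expR; lra.
Qed.

End Asymptotics.

Lemma prob_hop_diameter_xi (R : realType) : exists (C : R) (M : nat), 0 <= C /\
  forall (d : measure_display) (Omega : measurableType d) (P : probability Omega R)
    (n : nat) (s : R) (X : 'I_n -> 'I_3 -> Omega -> R) (m : nat) (r b : R)
    (xi := m%:R * expR (- (n%:R / m%:R ^+ 3 * #|octant|%:R)) : R),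
  0 < s -> iid_uniform_cube P s X -> (M <= m)%N -> 50 * (s / m%:R) <= r ->
  3 * (m%:R - 1) <= 25 * b -> xi <= 1 ->
  ((1 - C * xi)%:E <=
    P [set w | (@hop_diameter R n (rgg_adj (fun i k => X i k w) r) <= b%:E)%E])%E.
Proof.
pose k0 := (3 * #|octant|)%N.
(* The huge constant is kept behind an equation so that it is never evaluated. *)
have [D [D0 DE]] : exists D : R, 0 <= D /\ D = (2 ^ ((40 * block_len k0) ^ 3))%:R.
  by exists (2 ^ ((40 * block_len k0) ^ 3))%:R.
exists (D + 2 * 101 ^+ 2), (maxn 100 (grid_min k0)).
split=> [|d Omega P n s X m r b xi s0 iid]; first by rewrite addr_ge0 // mulr_ge0.
rewrite geq_max => /andP[m100 mM] sr mb xi1.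
have xi0 : 0 <= xi by rewrite mulr_ge0 // expR_ge0.
apply: le_trans (prob_hop_diameter s0 iid m100 mM sr mb).
rewrite -/k0 -DE -/xi lee_fin lerD2l lerN2; move: xi xi0 xi1 => x x0 x1; clear -D0 x0 x1.
have x3 : x ^+ 3 <= x by rewrite exprS -[leRHS]mulr1 ler_wpM2l // exprn_ile1.
have h1 : D * x ^+ 3 <= D * x by exact: ler_wpM2l.
have h2 : x * (100 + x) ^+ 2 <= x * 101 ^+ 2.
  by apply: ler_wpM2l => //; rewrite ler_sqr ?nnegrE; lra.
lra.
Qed.

Theorem theorem4 (R : realType) (d : measure_display) (Omega : measurableType d)
  (P : probability Omega R) (V : nat -> R) (rho l : R)
  (X : forall n : nat, 'I_n -> 'I_3 -> Omega -> R) :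
  (forall n, 0 < V n) ->
  0 < rho ->
  (fun n => n%:R / V n) @ \oo --> rho ->
  11 / 5 < l ->
  (forall n, iid_uniform_cube P (V n `^ (3^-1)) (X n)) ->
  (fun n : nat =>
     P [set w | (@hop_diameter R n
                  (rgg_adj (fun i c => X n i c w)
                     (((3 * (1 + l) * ln n%:R * V n) / (4 * pi * n%:R)) `^ (3^-1)))
                 <= (12 * ((pi * n%:R) / (6 * (1 + l) * ln n%:R)) `^ (3^-1))%:E)%E])
    @ \oo --> 1%E.
Proof.
move=> V0 _ _ l115 iid.
have pi0 := @pi_gt0 R; have pi165 := @pi_lt_16_5 R.
(* The condition [11 / 5 < l] enters here, through [pi < 16 / 5 < 1 + l]. *)
have [A [A34 AE]] : exists A : R, 3 / 4 <= A /\ A = 3 * (1 + l) / (4 * pi).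
  by exists (3 * (1 + l) / (4 * pi)); split=> //; rewrite ler_pdivlMr; lra.
have [C [M [C0 main]]] := prob_hop_diameter_xi R.
pose u (n : nat) : R := 51 * expR (- (ln n%:R / 375)).
have u0 n : 0 <= u n by apply: mulr_ge0; [exact: ler0n | exact: expR_ge0].
have u_cvg : u n @[n --> \oo] --> (0 : R).
  apply/cvgrPdist_le => e e0; near=> n; rewrite sub0r normrN ger0_norm //.
  have h : 375 * (51 / e) <= ln (n%:R : R) by near: n; exact: ln_nat_large.
  rewrite /u expRN ler_pdivrMr ?expR_gt0 // -ler_pdivrMl //.
  apply: le_trans (expR_ge1Dx _); rewrite mulrC; lra.
apply: (@squeeze_cvge _ _ _ _ (fun n => (1 - C * u n)%:E) _ (fun=> 1%E)); last first.
- exact: cvg_cst.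
- apply: cvg_EFin; first by near=> n.
  rewrite [X in _ --> X](_ : _ = 1 - C * 0 :> R); last by rewrite mulr0 subr0.
  by apply: cvgB; [exact: cvg_cst | apply: cvgMr].
near=> n; apply/andP; split; last first.
  apply: probability_le1; have [mX _] := iid n.
  exact: (measurable_graph_event mX _ (fun e => (hop_diameter R e <= _%:E)%E)).
have n1 : (1 < n)%N by near: n; exact: nbhs_infty_ge.
have n0 : 0 < n%:R :> R by rewrite ltr0n ltnW.
have l0 : 0 < ln (n%:R : R) by rewrite ln_gt0 // ltr1n.
have Al : 1 <= A * ln n%:R.
  have l2 : 2 <= ln (n%:R : R) by near: n; exact: ln_nat_large.
  by apply: le_trans (ler_pM _ _ A34 l2); lra.
have u1 : u n <= 1.
  near: n; move/cvgrPdist_le: u_cvg => /(_ 1 ltr01); apply: filterS => n.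
  by rewrite sub0r normrN => /(le_trans (ler_norm _)).
(* [q] is the side of the cube over the range; the volume cancels. The claimed bound is [6 * q], and
   [50 * q < m <= 50 * q + 1] gives both conditions relating [m] to the range and to this bound. *)
have [q [q0 q3 qK]] : exists q : R, [/\ 0 <= q, q ^+ 3 = n%:R / (A * ln n%:R) &
    20 + M%:R <= q].
  have x0 : 0 <= n%:R / (A * ln n%:R) by apply: divr_ge0; lra.
  exists ((n%:R / (A * ln n%:R)) `^ (3^-1)).
  rewrite powR_ge0 cube_powR3V //; split=> //.
  rewrite -(@ler_pXn2r _ 3) ?nnegrE ?powR_ge0 ?addr_ge0 // cube_powR3V //.
  rewrite invfM mulrCA mulrC ler_pdivlMr; last lra.
  by near: n; exact: nat_div_ln_large.
have M0 : 0 <= M%:R :> R by [].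
have q20 : 20 <= q by lra.
have xu := @xi_le _ n A q n1 A34 q20 Al q3.
have /andP[t1 t2] := @truncn_itv R (50 * q) ltac:(lra).
set m := (Num.truncn (50 * q)).+1 in xu t2.
have mE : m%:R = (Num.truncn (50 * q))%:R + 1 :> R by rewrite /m natr1.
have m0 : 0 < m%:R :> R by rewrite ltr0n.
clearbody m.
have [s [s0 sE]] : exists s : R, 0 < s /\ s = V n `^ (3^-1).
  by exists (V n `^ (3^-1)); rewrite powR_gt0.
have s3 : s ^+ 3 = V n by rewrite sE cube_powR3V // ltW.
have rE : (3 * (1 + l) * ln n%:R * V n / (4 * pi * n%:R)) `^ (3^-1) = s / q.
  rewrite (_ : _ / _ = (s / q) ^+ 3); first by rewrite powR3V_cube // divr_ge0 // ltW.
  rewrite expr_div_n q3 s3 AE; clear -n0 l0 pi0 l115.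
  by field; rewrite !gt_eqF //; lra.
have bE : 12 * (pi * n%:R / (6 * (1 + l) * ln n%:R)) `^ (3^-1) = 6 * q.
  rewrite (_ : _ / _ = (q / 2) ^+ 3); first by rewrite powR3V_cube; lra.
  rewrite expr_div_n q3 AE; clear -n0 l0 pi0 l115.
  by field; rewrite !gt_eqF //; lra.
rewrite rE bE; apply: le_trans (main _ _ _ _ s _ m _ _ s0 _ _ _ _ _).
- by rewrite lee_fin lerD2l lerN2 ler_wpM2l.
- by rewrite sE.
- by rewrite -(ler_nat R); lra.
- rewrite mulrCA ler_pM2l // ler_pdivrMr // mulrC ler_pdivlMr; last lra.
  exact: ltW.
- by lra.
- exact: le_trans xu u1.
Unshelve. all: by end_near. Qed.
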